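(* Let $X$ be a Hausdorff space, let $\tau^c$ be the family of all closed subsets of $X$ and $\mathcal C_X$ the family of all compact subsets of $X$. Let $Y$ be a Hausdorff space with a strictly increasing closed cover $\{B_n\}_{n\in\mathbb N}$. Then $X$ is $K$-semimetrizable if and only if there exists a map $\phi:\tau^c\to\mathcal L(X,\mathcal F(Y))$, $F\mapsto\phi_F$ (with $\phi_x:=\phi_{\{x\}}$ for $x\in X$), such that: (i) for each $F\in\tau^c$, $F=\bigcap_{n\in\mathbb N}\phi_F^{-1}[Y\setminus B_n]$; (ii) if $F_1,F_2\in\tau^c$ and $F_1\subset F_2$, then $\phi_{F_1}(x)\subset\phi_{F_2}(x)$ for all $x\in X$; (iii) for each $x\in X$ and $F\in\tau^c$ with $x\notin F$, $\phi_x$ is bounded on $F$; (iv) for all $K,H\in\mathcal C_X$ with $K\cap H=\emptyset$, $\phi_K$ is bounded on $H$.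
   Context: $\mathbb N$ is the set of positive integers. A sequence $\{B_n\}_{n\in\mathbb N}$ of closed subsets of a space $Y$ is a strictly increasing closed cover of $Y$ if $Y=\bigcup_{n}B_n$, $B_1\neq\emptyset$ and $B_n\subsetneq B_{n+1}$ for each $n$. $\mathcal F(Y)$ is the family of nonempty closed subsets of $Y$. For a set-valued map $\psi:X\to\mathcal F(Y)$ and $B\subset Y$, $\psi^{-1}[B]=\{x\in X:\psi(x)\cap B\neq\emptyset\}$ and $\psi^{\#}[B]=\{x\in X:\psi(x)\subset B\}$. $\psi$ is lower semi-continuous if $\psi^{-1}[V]$ is open in $X$ for each open $V\subset Y$; $\mathcal L(X,\mathcal F(Y))$ is the set of all lower semi-continuous maps $X\to\mathcal F(Y)$. $\psi$ is bounded on $A\subset X$ if $A\subset\psi^{\#}[B_n]$ for some $n\in\mathbb N$. Since $X$ is Hausdorff, compact subsets are closed, so $\phi_K$ makes sense for $K\in\mathcal C_X$. A semi-metric on a space $X$ is a function $d:X\times X\to[0,\infty)$ such that (1) $d(x,y)=0$ if and only if $x=y$; (2) $d(x,y)=d(y,x)$ for all $x,y\in X$; (3) for each $x\in X$, $\{B(x,r):r>0\}$ is a neighborhood base of $x$, where $B(x,r)=\{y\in X:d(x,y)<r\}$ (the sets $B(x,r)$ need not be open). $X$ is $K$-semimetrizable if there is a semi-metric $d$ on $X$ such that $d(K,H)>0$ for every disjoint pair $K,H$ of nonempty compact subsets of $X$, where $d(K,H)=\inf\{d(x,y):x\in K,\,y\in H\}$. *)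

(* Defs.v *)
From mathcomp Require Import all_boot all_order all_algebra.
From mathcomp Require Import all_classical all_reals all_analysis.

Set Implicit Arguments.
Unset Strict Implicit.
Unset Printing Implicit Defensive.

Import Order.TTheory GRing.Theory Num.Theory.

Local Open Scope classical_set_scope.
Local Open Scope ring_scope.

(* A sequence indexed by the positive integers is represented by a function on
   [nat] shifted by one: [B n] stands for the set with index n + 1, so that the
   first set of the cover is [B 0]. *)
Definition strictly_increasing_closed_cover (Y : topologicalType)
    (B : nat -> set Y) : Prop :=
  [/\ forall n, closed (B n),
      \bigcup_n B n = setT,
      B 0%N !=set0
    & forall n, B n `<` B n.+1].

Definition nonempty_closed (Y : topologicalType) : set (set Y) :=
  [set A | A !=set0 /\ closed A].

(* psi^{-1}[B] *)
Definition lower_preimage (X Y : Type) (psi : X -> set Y) (B : set Y) : set X :=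
  [set x | psi x `&` B !=set0].

(* psi^#[B] *)
Definition upper_preimage (X Y : Type) (psi : X -> set Y) (B : set Y) : set X :=
  [set x | psi x `<=` B].

Definition lsc_maps (X Y : topologicalType) : set (X -> set Y) :=
  [set psi | (forall x, nonempty_closed (psi x)) /\
             (forall V, open V -> open (lower_preimage psi V))].

Definition bounded_on_set (X Y : Type) (B : nat -> set Y) (psi : X -> set Y)
    (A : set X) : Prop :=
  exists n, A `<=` upper_preimage psi (B n).

Definition semiball (R : realType) (X : Type) (d : X -> X -> R) (x : X) (r : R) :
    set X :=
  [set y | d x y < r].

Definition semimetric (R : realType) (X : topologicalType) (d : X -> X -> R) :
    Prop :=
  [/\ forall x y, 0 <= d x y,
      forall x y, d x y = 0 <-> x = y,
      forall x y, d x y = d y x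
    & forall x,
        (forall r, 0 < r -> nbhs x (semiball d x r)) /\
        (forall U, nbhs x U -> exists2 r, 0 < r & semiball d x r `<=` U)].

(* Only used for nonempty [K] and [H] and nonnegative [d], where the real
   infimum [inf] is the genuine one (it is 0 on the empty set). *)
Definition set_dist (R : realType) (X : Type) (d : X -> X -> R) (K H : set X) :
    R :=
  inf [set d x y | x in K & y in H].

Definition K_semimetrizable (R : realType) (X : topologicalType) : Prop :=
  exists d : X -> X -> R, semimetric d /\
    forall K H : set X, compact K -> compact H ->
      K !=set0 -> H !=set0 -> K `&` H = set0 -> 0 < set_dist d K H.

(* Main.v *)
Require Import Defs.
From mathcomp Require Import all_boot all_order all_algebra.
From mathcomp Require Import all_classical all_reals all_analysis.

Set Implicit Arguments.
Unset Strict Implicit.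
Unset Printing Implicit Defensive.

Import Order.TTheory GRing.Theory Num.Theory.

Local Open Scope classical_set_scope.
Local Open Scope ring_scope.

(** Both sides of the equivalence are reformulations of the same structure on
    [X], in which neither the numbers nor the space [Y] occur: an assignment, to
    each closed set [F], of a decreasing sequence of open sets [U n F] with
    intersection [F], monotone in [F], such that [U n [set x]] eventually misses
    every closed set that avoids [x], and [U n K] eventually misses every compact
    set disjoint from a compact set [K] ([open_expansion] below).

    From a semi-metric, [U n F] is the interior of the union of the balls of
    radius [1/(n+1)] centred in [F] ([metric_expansionP]).  Conversely
    ([expansion_K_semimetrizable]), one declares [x] and [y] to be
    [n]-near when [y] is in [U n [set x]] or [x] is in [U n [set y]], and lets
    [d x y < 1/(n+1)] mean [n]-near.  Such a [d] is symmetric by construction.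
    Its balls are neighbourhoods because they contain the sets [U n [set x]], and
    they form a base because, for [F] closed and [x] outside [F], the point
    condition excludes [F] from [U n [set x]] while [x] is excluded from all the
    [U n [set y]] with [y] in [F] at once, by monotonicity, as soon as [x] is not
    in [U n F].  The compact condition is used for the pairs [(K, H)] and
    [(H, K)] together, since nearness has two halves.

    The cover [B] translates sequences of sets into set-valued maps.  From [U],
    the point [x] is sent to the intersection of the [B n] with [x] outside
    [U n F].  This is [Y] on [F], and otherwise the first member [B n] of the
    cover for which [x] is not in [U n F] ([cover_map_lsc], [cover_map_bigcap]).
    From [phi], the sets are
    [U n F := phi_F^{-1}[Y \ B n]], open by lower semi-continuity, and [phi_F] is
    bounded by [B n] on a set precisely when that set misses [U n F]. *)

(** The structure on [X] common to both sides of the equivalence; the separation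
    clauses say that [U n _] is disjoint from the other set. *)
Record open_expansion (X : topologicalType) (U : nat -> set X -> set X) : Prop :=
  OpenExpansion {
    expansion_open : forall n F, closed F -> open (U n F);
    expansion_bigcap : forall F, closed F -> F = \bigcap_n U n F;
    expansion_nonincr : forall m n F, closed F -> (m <= n)%N ->
      U n F `<=` U m F;
    expansion_mono : forall n F1 F2, closed F1 -> closed F2 -> F1 `<=` F2 ->
      U n F1 `<=` U n F2;
    expansion_sep_point : forall x F, closed F -> ~ F x ->
      exists n, F `<=` ~` U n [set x];
    expansion_sep_compact : forall K H, compact K -> compact H ->
      K `&` H = set0 -> exists n, H `<=` ~` U n K }.

(** * Expansions and semi-metrics *)

Lemma hausdorff_closed_set1 (X : topologicalType) :
  hausdorff_space X -> forall x : X, closed [set x].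
Proof. by move=> /hausdorff_accessible/accessible_closed_set1. Qed.

Lemma exists_natSinv_lt (R : realType) (e : R) :
  0 < e -> exists n : nat, n.+1%:R^-1 < e.
Proof.
move=> e0; have [n _ /(_ n (leqnn n)) ltne] := near_infty_natSinv_lt (PosNum e0).
by exists n.
Qed.

Lemma natSinv_lt (R : realType) (m n : nat) :
  (m.+1%:R^-1 < n.+1%:R^-1 :> R) = (n < m)%N.
Proof. by rewrite ltf_pV2 ?posrE ?ltr0n// ltr_nat. Qed.

Definition metric_expansion (R : realType) (X : topologicalType)
    (d : X -> X -> R) (n : nat) (F : set X) : set X :=
  (\bigcup_(x in F) semiball d x n.+1%:R^-1)°.

Lemma metric_expansionP (R : realType) (X : topologicalType) (d : X -> X -> R) :
  semimetric d ->
  (forall K H : set X, compact K -> compact H ->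
     K !=set0 -> H !=set0 -> K `&` H = set0 -> 0 < set_dist d K H) ->
  open_expansion (metric_expansion d).
Proof.
move=> [d_ge0 d_eq0 d_sym d_nbhs] d_sep; split.
- by move=> n F _; exact: open_interior.
- move=> F clF; apply/seteqP; split => [x Fx n _|x Ux].
    have x_ball : nbhs x (semiball d x n.+1%:R^-1).
      by apply: (proj1 (d_nbhs x)); rewrite invr_gt0 ltr0n.
    by apply: filterS x_ball => y dxy; exists x.
  (* membership in all the expansions makes every ball of [x] meet [F] *)
  apply: clF => V /(proj2 (d_nbhs x)) [r r0 rV].
  have [n nr] := exists_natSinv_lt r0.
  have [y Fy dyx] := interior_subset (Ux n Logic.I).
  exists y; split=> //; apply: rV.
  by rewrite /semiball/= d_sym; exact: lt_trans dyx nr.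
- move=> m n F _ mn; apply: interiorS => y [x Fx dxy].
  by exists x => //; apply: lt_le_trans dxy _; rewrite leNgt natSinv_lt -leqNgt.
- move=> n F1 F2 _ _ F12; apply: interiorS => y [x Fx dxy].
  by exists x => //; exact: F12.
- move=> x F clF nFx.
  have /(proj2 (d_nbhs x)) [r r0 rF] : nbhs x (~` F).
    by apply: open_nbhs_nbhs; split => //; exact: closed_openC.
  have [n nr] := exists_natSinv_lt r0.
  exists n => y Fy /interior_subset [_ -> dxy].
  by apply: (rF y) => //; exact: lt_trans dxy nr.
- move=> K H cK cH KH.
  have [K0|K0] := pselect (K !=set0); last first.
    by exists 0%N => y _ /interior_subset [x Kx _]; apply: K0; exists x.
  have [H0|H0] := pselect (H !=set0); last first.
    by exists 0%N => y Hy; case: H0; exists y.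
  have [n nr] := exists_natSinv_lt (d_sep K H cK cH K0 H0 KH).
  exists n => y Hy /interior_subset [x Kx dxy].
  have : set_dist d K H <= d x y.
    apply: ge_inf; last by exists x => //; exists y.
    by exists 0 => _ [a _ [b _ <-]].
  by rewrite leNgt => /negP; apply; exact: lt_trans dxy nr.
Qed.

(** For decreasing [P], this is [0] if all [P n] hold and [1/(m+1)] if [P m] is
    the first to fail. As a function of [P] alone it respects equivalence of
    sequences, so a relation symmetric in [x] and [y] gives a symmetric
    distance. *)
Definition gauge (R : realType) (P : nat -> Prop) : R :=
  xget 0 [set r : R | 0 <= r /\ forall n : nat, r < n.+1%:R^-1 <-> P n].

Lemma gaugeP (R : realType) (P : nat -> Prop) :
  (forall m n, (m <= n)%N -> P n -> P m) ->
  0 <= gauge R P /\ forall n : nat, gauge R P < n.+1%:R^-1 <-> P n.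
Proof.
move=> Pdec; apply: (@xgetPex _ 0
  [set r : R | 0 <= r /\ forall n : nat, r < n.+1%:R^-1 <-> P n]).
have [Pall|/existsNP nP] := pselect (forall n, P n).
  by exists 0; split=> // n; split.
have exP : exists n, ~~ `[< P n >] by have [n Pn] := nP; exists n; exact/asboolPn.
case: (ex_minnP exP) => m /asboolPn nPm m_min.
exists m.+1%:R^-1; split=> [|n]; first by rewrite invr_ge0 ler0n.
rewrite natSinv_lt; split=> [|Pn].
  by rewrite ltnNge => /negP nm; apply: contrapT => /asboolPn /m_min.
by rewrite ltnNge; apply/negP => mn; apply: nPm; exact: Pdec mn Pn.
Qed.

Definition near_at (X : Type) (U : nat -> set X -> set X) (x y : X) (n : nat) :
    Prop :=
  U n [set x] y \/ U n [set y] x.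

Lemma near_at_nonincr (X : topologicalType) (U : nat -> set X -> set X)
    (hX : hausdorff_space X) (hU : open_expansion U) (x y : X) (m n : nat) :
  (m <= n)%N -> near_at U x y n -> near_at U x y m.
Proof.
have cl1 := hausdorff_closed_set1 hX.
by move=> mn [h|h]; [left|right]; exact: (expansion_nonincr hU (cl1 _) mn h).
Qed.

(** The compact condition, used in both orders, keeps the pairs in [K * H] out
    of the relation [near_at _ _ _ n] for one fixed [n]. *)
Lemma near_at_sep_compact (X : topologicalType) (U : nat -> set X -> set X)
    (hX : hausdorff_space X) (hU : open_expansion U) (K H : set X) :
  compact K -> compact H -> K `&` H = set0 ->
  exists n, forall x y, K x -> H y -> ~ near_at U x y n.
Proof.
move=> cK cH KH.
have cl1 := hausdorff_closed_set1 hX.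
have [clK clH] := (compact_closed hX cK, compact_closed hX cH).
have [i iP] := expansion_sep_compact hU cK cH KH.
have [j jP] : exists j, K `<=` ~` U j H.
  by apply: (expansion_sep_compact hU) => //; rewrite setIC.
exists (maxn i j) => x y Kx Hy [h|h].
  apply: (iP y Hy); apply: (expansion_nonincr hU clK (leq_maxl i j)).
  by apply: (expansion_mono hU (cl1 x) clK) h => _ ->.
apply: (jP x Kx); apply: (expansion_nonincr hU clH (leq_maxr i j)).
by apply: (expansion_mono hU (cl1 y) clH) h => _ ->.
Qed.

Lemma near_at_sep_point (X : topologicalType) (U : nat -> set X -> set X)
    (hX : hausdorff_space X) (hU : open_expansion U) (x : X) (F : set X) :
  closed F -> ~ F x -> exists n, forall y, F y -> ~ near_at U x y n.
Proof.
move=> clF nFx.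
have cl1 := hausdorff_closed_set1 hX.
have [i iP] := expansion_sep_point hU clF nFx.
have [j jP] : exists j, ~ U j F x.
  apply/existsNP => Ux; apply: nFx.
  by rewrite (expansion_bigcap hU clF) => j _.
exists (maxn i j) => y Fy [h|h].
  exact: (iP y Fy (expansion_nonincr hU (cl1 x) (leq_maxl i j) h)).
apply: jP; apply: (expansion_nonincr hU clF (leq_maxr i j)).
by apply: (expansion_mono hU (cl1 y) clF) h => _ ->.
Qed.

Lemma expansion_K_semimetrizable (R : realType) (X : topologicalType)
    (U : nat -> set X -> set X) :
  hausdorff_space X -> open_expansion U -> K_semimetrizable R X.
Proof.
move=> hX hU; pose d x y : R := gauge R (near_at U x y).
have cl1 := hausdorff_closed_set1 hX.
have dP x y := gaugeP R (near_at_nonincr hX hU (x:=x) (y:=y)).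
have d_ge0 x y : 0 <= d x y := proj1 (dP x y).
have dlt x y n : d x y < n.+1%:R^-1 <-> near_at U x y n := proj2 (dP x y) n.
have Uxx n x : U n [set x] x.
  by have := erefl x : [set x] x; rewrite {1}(expansion_bigcap hU (cl1 x)); apply.
exists d; split; last first.
  move=> K H cK cH [x0 Kx0] [y0 Hy0] KH.
  have [n nP] := near_at_sep_compact hX hU cK cH KH.
  apply: (@lt_le_trans _ _ n.+1%:R^-1); first by rewrite invr_gt0 ltr0n.
  apply: lb_le_inf; first by exists (d x0 y0); exists x0 => //; exists y0.
  move=> _ [x Kx [y Hy <-]]; rewrite leNgt; apply/negP => /dlt.
  exact: nP.
split=> //.
- move=> x y; split=> [dxy|->].
    apply: contrapT => nxy.
    have [n nP] := near_at_sep_point hX hU (cl1 y) (nxy : ~ [set y] x).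
    by apply: (nP y erefl); apply/dlt; rewrite dxy invr_gt0 ltr0n.
  apply/eqP; rewrite eq_le d_ge0 andbT leNgt.
  apply/negP => /exists_natSinv_lt [n]; apply/negP; rewrite -leNgt.
  by apply: ltW; apply/dlt; left.
- move=> x y; congr (gauge R _); apply/funext => n; apply/propext.
  by split=> -[] ?; [right|left|right|left].
- move=> x; split=> [r /exists_natSinv_lt [n nr]|V].
    have : nbhs x (U n [set x]).
      by apply: open_nbhs_nbhs; split; [exact: expansion_open|exact: Uxx].
    by apply: filterS => y Uy; apply: lt_trans nr; apply/dlt; left.
  rewrite nbhsE => -[W [oW Wx] WV].
  have [n nP] := near_at_sep_point hX hU (open_closedC oW) (fun nWx => nWx Wx).
  exists n.+1%:R^-1; first by rewrite invr_gt0 ltr0n.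
  by move=> y /dlt near_xy; apply: WV; apply: contrapT => /nP.
Qed.

(** * Expansions and lower semi-continuous maps *)

Definition cover_map (X Y : Type) (B : nat -> set Y) (U : nat -> set X -> set X)
    (F : set X) (x : X) : set Y :=
  [set y | forall n, ~ U n F x -> B n y].

Lemma cover_nondecr (Y : topologicalType) (B : nat -> set Y) (m n : nat) :
  strictly_increasing_closed_cover B -> (m <= n)%N -> B m `<=` B n.
Proof.
move=> [_ _ _ Bincr] /subnK <-; elim: (n - m)%N => [//|k IH] y /IH.
by rewrite addSn; apply: (proj1 (Bincr _)).
Qed.

Lemma open_forall_lt (X : topologicalType) (V : nat -> set X) (m : nat) :
  (forall n, open (V n)) -> open [set x | forall n, (n < m)%N -> V n x].
Proof.
move=> oV; elim: m => [|m IH].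
  by rewrite (_ : mkset _ = setT); [exact: openT|apply/seteqP; split].
rewrite (_ : mkset _ = [set x | forall n, (n < m)%N -> V n x] `&` V m).
  exact: openI.
apply/seteqP; split => [x xV|x [xV xm] n].
  by split=> [n nm|]; apply: xV => //; exact: ltnW.
by rewrite ltnS leq_eqVlt => /predU1P[->//|/xV].
Qed.

(** A point [y] of [B m] belongs to the value at [x] as soon as [x] is in the
    finitely many open sets [U n F] with [n < m] and [y] outside [B n]. The set
    of those [x] is therefore open for each [y] separately. *)
Lemma cover_map_lsc (X Y : topologicalType) (B : nat -> set Y)
    (U : nat -> set X -> set X) (F : set X) :
  strictly_increasing_closed_cover B -> open_expansion U -> closed F ->
  lsc_maps (cover_map B U F).
Proof.
move=> hB hU clF; have [Bcl BT [y0 By0] _] := hB; split=> [x|V _].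
  split; first by exists y0 => n _; exact: (cover_nondecr hB (leq0n n)).
  rewrite (_ : cover_map B U F x = \bigcap_(n in [set n | ~ U n F x]) B n) //.
  by apply: closed_bigI => n _; exact: Bcl.
rewrite (_ : lower_preimage _ _ =
    \bigcup_(y in V) [set x | cover_map B U F x y]); last first.
  by apply/seteqP; split=> [x [y [xy Vy]]|x [y Vy xy]]; exists y.
apply: bigcup_open => y _.
have [m _ Bmy] : (\bigcup_n B n) y by rewrite BT.
pose V' n := [set x | ~ B n y -> U n F x].
have oV' n : open (V' n).
  have [Bny|nBny] := pselect (B n y).
    rewrite (_ : V' n = setT); first exact: openT.
    by apply/seteqP; split=> // x _ /(_ Bny).
  rewrite (_ : V' n = U n F); first exact: expansion_open.
  by apply/seteqP; split=> [x /(_ nBny)|x Ux _].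
rewrite (_ : mkset _ = [set x | forall n, (n < m)%N -> V' n x]).
  exact: open_forall_lt.
apply/seteqP; split=> [x xy n _ nBny|x xV n nU].
  by apply: contrapT => /xy.
have [nm|mn] := ltnP n m; last exact: (cover_nondecr hB mn).
by apply: contrapT => nBny; exact/nU/xV.
Qed.

(** Strictness of the cover enters here: [Y] itself has points outside each
    [B n], which is what makes the value [Y] at the points of [F] unbounded. *)
Lemma cover_map_bigcap (X Y : topologicalType) (B : nat -> set Y)
    (U : nat -> set X -> set X) (F : set X) :
  strictly_increasing_closed_cover B -> open_expansion U -> closed F ->
  F = \bigcap_n lower_preimage (cover_map B U F) (~` B n).
Proof.
move=> [_ _ _ Bincr] hU clF; apply/seteqP; split=> x.
  rewrite {1}(expansion_bigcap hU clF) => Ux n _.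
  have [_ /existsNP [y /not_implyP [_ nBy]]] := Bincr n.
  by exists y; split=> // k; have := Ux k Logic.I.
move=> xP; rewrite (expansion_bigcap hU clF) => n _.
have [y [xy nBy]] := xP n Logic.I.
by apply: contrapT => /xy.
Qed.

Lemma cover_map_bounded (X Y : Type) (B : nat -> set Y)
    (U : nat -> set X -> set X) (F A : set X) :
  (exists n, A `<=` ~` U n F) -> bounded_on_set B (cover_map B U F) A.
Proof. by move=> [n AU]; exists n => x Ax y; apply; exact: AU. Qed.

Lemma bounded_lower_preimage (X Y : Type) (B : nat -> set Y)
    (psi : X -> set Y) (A : set X) :
  bounded_on_set B psi A ->
  exists n, A `<=` ~` lower_preimage psi (~` B n).
Proof.
by move=> [n AB]; exists n => x Ax [y [xy nBy]]; apply: nBy; exact: AB xy.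
Qed.

(* The map F |-> phi_F is a total function on [set X] whose values matter only
   at closed sets. *)
Theorem theorem4p2 (R : realType) (X Y : topologicalType) (B : nat -> set Y)
    (hX : hausdorff_space X) (hY : hausdorff_space Y)
    (hB : strictly_increasing_closed_cover B) :
  K_semimetrizable R X <->
  exists phi : set X -> X -> set Y,
    (forall F : set X, closed F -> lsc_maps (phi F)) /\
    [/\ forall F : set X, closed F ->
          F = \bigcap_n lower_preimage (phi F) (~` B n),
        forall F1 F2 : set X, closed F1 -> closed F2 -> F1 `<=` F2 ->
          forall x, phi F1 x `<=` phi F2 x,
        forall (x : X) (F : set X), closed F -> ~ F x ->
          bounded_on_set B (phi [set x]) F
      & forall K H : set X, compact K -> compact H -> K `&` H = set0 ->
          bounded_on_set B (phi K) H].
Proof.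
split=> [[d [d_semi d_sep]]|[phi [phi_lsc [phi_cap phi_mono phi_pt phi_cpt]]]].
  have hU := metric_expansionP d_semi d_sep.
  exists (cover_map B (metric_expansion d)); split.
    by move=> F clF; exact: cover_map_lsc.
  split.
  - by move=> F clF; exact: cover_map_bigcap.
  - move=> F1 F2 cl1 cl2 F12 x y yF1 n nU2; apply: yF1 => U1.
    by apply: nU2; exact: (expansion_mono hU cl1 cl2 F12) U1.
  - move=> x F clF nFx; apply: cover_map_bounded.
    exact: (expansion_sep_point hU).
  - move=> K H cK cH KH; apply: cover_map_bounded.
    exact: (expansion_sep_compact hU).
apply: (@expansion_K_semimetrizable R X
  (fun n F => lower_preimage (phi F) (~` B n)) hX).
split.
- move=> n F clF; apply: (proj2 (phi_lsc F clF)).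
  by apply: closed_openC; have [Bcl _ _ _] := hB; exact: Bcl.
- exact: phi_cap.
- move=> m n F _ mn x [y [xy nBy]]; exists y; split=> // Bmy.
  by apply: nBy; exact: (cover_nondecr hB mn).
- move=> n F1 F2 cl1 cl2 F12 x [y [xy nBy]]; exists y; split=> //.
  exact: (phi_mono F1 F2).
- by move=> x F clF nFx; exact/bounded_lower_preimage/phi_pt.
- by move=> K H cK cH KH; exact/bounded_lower_preimage/phi_cpt.
Qed.
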